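(* For every real $x$ and every $n\in\mathbb{N}$ ($n\ge 1$), $$E\big[(x-Y)_{n,\lambda}\big]=d_{n,\lambda}^{Y}(x)-n\,d_{n-1,\lambda}^{Y}(x).$$ In particular, for $x=0$, $$(-1)^{n}E\big[\langle Y\rangle_{n,\lambda}\big]=d_{n,\lambda}^{Y}-n\,d_{n-1,\lambda}^{Y}\qquad (n\ge 1).$$
   Context: Let $\lambda$ be a nonzero real number. Set $(x)_{0,\lambda}=1$, $(x)_{k,\lambda}=x(x-\lambda)\cdots(x-(k-1)\lambda)$ and $\langle x\rangle_{0,\lambda}=1$, $\langle x\rangle_{k,\lambda}=x(x+\lambda)\cdots(x+(k-1)\lambda)$ for $k\ge 1$. The degenerate exponential is $e_{\lambda}^{x}(t)=\sum_{k\ge 0}(x)_{k,\lambda}\frac{t^{k}}{k!}$ (so $e_\lambda^x(t)=(1+\lambda t)^{x/\lambda}$ for $t$ near $0$). $Y$ is a real random variable whose moment generating function $E[e^{tY}]=\sum_{n\ge 0}E[Y^n]\frac{t^n}{n!}$ exists for $|t|<r$, for some $r>0$. $E$ denotes expectation. The probabilistic degenerate derangement polynomials associated with $Y$, $d_{n,\lambda}^{Y}(x)$, are defined by $$\frac{1}{1-t}E\big[e_{\lambda}^{x-Y}(t)\big]=\sum_{n=0}^{\infty}d_{n,\lambda}^{Y}(x)\frac{t^{n}}{n!}$$ (power series in $t$ near $0$), and $d_{n,\lambda}^{Y}=d_{n,\lambda}^{Y}(0)$. *)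

(* Defs.v *)
From HB Require Import structures.
From mathcomp Require Import all_boot all_order all_algebra.
From mathcomp Require Import all_classical all_reals all_analysis.

Set Implicit Arguments.
Unset Strict Implicit.
Unset Printing Implicit Defensive.

Import Order.TTheory GRing.Theory Num.Theory.
Import numFieldNormedType.Exports.

Local Open Scope classical_set_scope.
Local Open Scope ring_scope.

Definition degen_falling (R : realType) (lambda x : R) (k : nat) : R :=
  \prod_(i < k) (x - i%:R * lambda).

Definition degen_rising (R : realType) (lambda x : R) (k : nat) : R :=
  \prod_(i < k) (x + i%:R * lambda).

(* The series converges whenever |lambda * t| < 1; outside its domain of
   convergence [limn] is a junk value, so this is only used for t near 0. *)
Definition degen_exp (R : realType) (lambda x t : R) : R :=
  limn (pseries (fun k => degen_falling lambda x k / k`!%:R) t).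

(* The expectation is extended-real valued: its being finite near 0 is part of
   the identity, as is the convergence of the power series. *)
Definition derangement_gf d (T : measurableType d) (R : realType)
    (P : probability T R) (Y : {RV P >-> R}) (lambda x : R)
    (a : nat -> R) : Prop :=
  \forall t \near (0 : R),
    let S := pseries (fun n => a n / n`!%:R) t in
    cvgn S /\
    (((1 - t)^-1)%:E *
       'E_P[fun w => degen_exp lambda (x - Y w) t] = (limn S)%:E)%E.

(* The sequence characterised by [derangement_gf], unique when it exists by the
   identity theorem for power series; the default value 0 is used only if
   there is none. *)
Definition derangement_poly d (T : measurableType d) (R : realType)
    (P : probability T R) (Y : {RV P >-> R}) (lambda : R) (n : nat)
    (x : R) : R :=
  xget (fun=> 0) [set a : nat -> R | derangement_gf Y lambda x a] n.

Definition derangement_number d (T : measurableType d) (R : realType)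
    (P : probability T R) (Y : {RV P >-> R}) (lambda : R) (n : nat) : R :=
  derangement_poly Y lambda n 0.

(* Main.v *)
Require Import Defs.
From HB Require Import structures.
From mathcomp Require Import all_boot all_order all_algebra.
From mathcomp Require Import all_classical all_reals all_analysis.
From mathcomp Require Import measurable_realfun ring lra.

Set Implicit Arguments.
Unset Strict Implicit.
Unset Printing Implicit Defensive.

Import Order.TTheory GRing.Theory Num.Theory.
Import numFieldNormedType.Exports.

Local Open Scope classical_set_scope.
Local Open Scope ring_scope.

(** Write [f_k = (x - Y)_{k,lambda} / k!], so that the degenerate exponential
    of [x - Y] is the power series with random coefficients [f_k].  If
    expectation and summation may be exchanged for small [t], then the
    coefficients of [E[e_lambda^(x - Y)(t)]] are [E[f_k]], and dividing by
    [1 - t] replaces them with their partial sums.  Thus the derangement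
    polynomials are [d_n = n! (E[f_0] + ... + E[f_n])], and
    [d_n - n d_(n-1) = n! E[f_n] = E[(x - Y)_{n,lambda}]].  The case [x = 0]
    follows from [(-y)_{n,lambda} = (-1)^n <y>_{n,lambda}].

    Two points need analysis.

    The exchange is dominated convergence ([expectation_pseries]).  The
    domination comes from [degen_falling_bound]: each factor of
    [(y)_{k,lambda}] is at most [u = |y| + k |lambda|], and
    [u^k / k! <= expR (c u) / c^k], which gives
    [|(y)_{k,lambda} / k!| <= expR (c |y|) q^k] with [q] independent of [y].
    For [c = r / 2] the random variable [expR (c |x - Y|)] is integrable because
    the moment generating function is finite at [c] and [-c].

    The derangement polynomials are specified only as some sequence satisfying
    the generating function identity, hence they are computed from the explicit
    sequence ([derangement_gf_partial_sums]) through uniqueness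
    ([derangement_gf_inj]), an instance of the identity theorem for power series
    ([pseries_inj]). *)

(** * Power series *)

Lemma sum_expr_le (R : realType) (z : R) (n : nat) : 0 <= z < 1 ->
  \sum_(0 <= k < n) z ^+ k <= (1 - z)^-1.
Proof.
move=> /andP[z0 z1]; have z1' : 0 < 1 - z by rewrite subr_gt0.
have := geometric_seriesE 1 (negbT (lt_eqF z1)) => /(congr1 (fun f => f n)).
rewrite /series/=; under eq_bigr do rewrite mul1r.
by move=> ->; rewrite mul1r ler_pdivrMr// mulVf ?gt_eqF// gerBl exprn_ge0.
Qed.

Lemma cvg_pseries_of_bound (R : realType) (a : nat -> R) (K q t : R) :
  (forall n, `|a n| <= K * q ^+ n) -> `|t| * q < 1 -> 0 <= q ->
  cvgn (pseries a t).
Proof.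
move=> aK tq q0; have K0 : 0 <= K.
  by have := aK 0%N; rewrite expr0 mulr1; exact: le_trans.
apply: normed_cvg; rewrite /normed_series_of /=.
apply: (@series_le_cvg _ _ (geometric K (`|t| * q))) => n //=.
- by rewrite mulr_ge0// exprn_ge0// mulr_ge0.
- by rewrite normrM normrX mulrC exprMn mulrCA ler_wpM2l ?exprn_ge0.
- by apply: is_cvg_geometric_series; rewrite ger0_norm// mulr_ge0.
Qed.

(** The remainder is [t] times a series dominated by a geometric one; the bound
    tends to 0 with [t], uniformly in [n]. *)
Lemma pseries_sub_constant_le (R : realType) (a : nat -> R) (K q t : R)
    (n : nat) :
  (forall n, `|a n| <= K * q ^+ n) -> 0 <= q -> `|t| * q < 1 ->
  `|pseries a t n.+1 - a 0%N| <= K * (`|t| * q) / (1 - `|t| * q).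
Proof.
move=> aK q0 tq1; have K0 : 0 <= K.
  by have := aK 0%N; rewrite expr0 mulr1; exact: le_trans.
have tq0 : 0 <= `|t| * q by rewrite mulr_ge0.
rewrite /pseries /series /= big_nat_recl//= expr0 mulr1 addrAC subrr add0r.
apply: (le_trans (ler_norm_sum _ _ _)).
apply: (@le_trans _ _
    (K * (`|t| * q) * \sum_(0 <= i < n) (`|t| * q) ^+ i)); last first.
  by rewrite ler_wpM2l ?sum_expr_le ?tq0// mulr_ge0.
rewrite mulr_sumr; apply: ler_sum => i _.
rewrite normrM normrX -[leRHS]mulrA -exprS exprMn (mulrC (`|t| ^+ _)) mulrA.
by rewrite ler_wpM2r ?exprn_ge0.
Qed.

(** Convergence at a single point [s] bounds the coefficients geometrically, so
    the constant term is the limit of the vanishing sums as [t] tends to 0.  The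
    hypothesis is on a punctured neighbourhood because at [t = 0] it would be
    the conclusion itself; this is also what lets [pseries_cvg0_eq0] divide by
    [t]. *)
Lemma pseries_cvg0_constant (R : realType) (a : nat -> R) :
  (\forall t \near (0 : R)^', pseries a t @ \oo --> 0) -> a 0%N = 0.
Proof.
rewrite near_withinE => /nbhs_ballP[e /= e0 ae].
have cvt t : 0 < t < e -> pseries a t @ \oo --> 0.
  move=> /andP[t0 te]; apply: ae; last by rewrite gt_eqF.
  by rewrite -ball_normE/= sub0r normrN gtr0_norm.
pose s := e / 2.
have s0 : 0 < s by rewrite divr_gt0.
have /cvgP/cvg_series_cvg_0/cvgP/cvg_seq_bounded : pseries a s @ \oo --> 0.
  by apply: cvt; rewrite s0 /s; lra.
move=> /pinfty_ex_gt0[K K0 /= sK].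
have aK n : `|a n| <= K * s^-1 ^+ n.
  rewrite exprVn ler_pdivlMr ?exprn_gt0// -[X in _ * X]gtr0_norm ?exprn_gt0//.
  by rewrite -normrM; exact: sK.
apply/eqP; rewrite -normr_eq0; apply/eqP/le_anti; rewrite normr_ge0 andbT.
apply/ler_addgt0Pl => eps eps0; rewrite addr0.
(* [x = |t| / s] is the ratio of the dominating geometric series at [t = x s];
   it is small enough for [K x / (1 - x) <= 2 K x <= eps]. *)
pose x := Num.min (1/2) (eps / (2 * K)).
have x0 : 0 < x by rewrite lt_min divr_gt0//= divr_gt0// mulr_gt0.
have x1 : x <= 1/2 by rewrite /x ge_min lexx.
have x2 : 2 * K * x <= eps.
  by rewrite mulrC -ler_pdivlMr ?mulr_gt0// /x ge_min lexx orbT.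
have nx : `|x * s| * s^-1 = x.
  by rewrite gtr0_norm ?mulr_gt0// mulfK// gt_eqF.
have cx : (fun n => pseries a (x * s) n.+1 - a 0%N) @ \oo --> 0 - a 0%N.
  apply: cvgB; last exact: cvg_cst.
  rewrite (cvg_shiftS (pseries a (x * s))); apply: cvt.
  by rewrite mulr_gt0//= /s; nra.
rewrite -[a 0%N]opprK normrN -[- a 0%N]add0r.
move/cvg_norm: (cx) => /(cvg_lim (@norm_hausdorff _ _)) <-.
apply: limr_le; first by apply: is_cvg_norm; apply/cvgP: cx.
near=> n.
apply: (le_trans (pseries_sub_constant_le n aK _ _)); rewrite ?nx ?invr_ge0 ?(ltW s0)//.
  by lra.
rewrite ler_pdivrMr; last by lra.
nra.
Unshelve. all: by end_near. Qed.

(** Once the constant term is 0, dividing by [t] shifts the coefficients and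
    preserves the hypothesis. *)
Lemma pseries_cvg0_eq0 (R : realType) (a : nat -> R) (n : nat) :
  (\forall t \near (0 : R)^', pseries a t @ \oo --> 0) -> a n = 0.
Proof.
elim: n a => [|n IHn] a a0; first exact: pseries_cvg0_constant.
have a00 := pseries_cvg0_constant a0.
apply: (IHn (fun n => a n.+1)); near=> t.
have t0 : t != 0 by near: t; exact: nbhs_dnbhs_neq.
have at0 : pseries a t @ \oo --> 0 by near: t.
rewrite -[0](mulr0 t^-1).
have -> : pseries (fun n => a n.+1) t = (fun n => t^-1 * pseries a t n.+1).
  apply/funext => k; rewrite /pseries /series /= big_nat_recl//= a00 mul0r add0r.
  by rewrite mulr_sumr; apply: eq_bigr => i _; rewrite exprS mulrCA mulKf.
by apply: cvgMl_tmp; rewrite (cvg_shiftS (pseries a t)).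
Unshelve. all: by end_near. Qed.

(** Identity theorem for real power series at 0. *)
Lemma pseries_inj (R : realType) (a b : nat -> R) :
  (\forall t \near (0 : R), [/\ cvgn (pseries a t), cvgn (pseries b t) &
     limn (pseries a t) = limn (pseries b t)]) -> a = b.
Proof.
move=> ab; apply/funext => n; apply/eqP; rewrite -subr_eq0; apply/eqP.
apply: (@pseries_cvg0_eq0 _ (fun n => a n - b n)).
rewrite near_withinE; apply: filterS ab => t [ca cb lab] _.
have -> : pseries (fun n => a n - b n) t = pseries a t - pseries b t.
  apply/funext => k; rewrite /pseries /series/=.
  by under eq_bigr do rewrite mulrBl; rewrite sumrB.
by rewrite -[0](subrr (limn (pseries a t))) {2}lab; apply: cvgB.
Qed.

(** Multiplying by [1 - t] telescopes the partial sums of [b] up to the boundary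
    term [t^n (b_0 + ... + b_(n-1))].  The bound [2 <= q] makes the partial sums
    of [b] obey the same geometric bound as [b], so that this term tends to 0 as
    soon as [|t| q < 1]. *)
Lemma cvg_pseries_partial_sums (R : realType) (b : nat -> R) (K q t l : R) :
  (forall n, `|b n| <= K * q ^+ n) -> 2 <= q -> `|t| * q < 1 ->
  pseries b t @ \oo --> l ->
  pseries (fun n => series b n.+1) t @ \oo --> (1 - t)^-1 * l.
Proof.
move=> bK q2 tq bl.
have q0 : 0 < q by lra.
have K0 : 0 <= K.
  by have := bK 0%N; rewrite expr0 mulr1; exact: le_trans.
have t1 : `|t| < 1 by apply: le_lt_trans tq; rewrite ler_peMr//; lra.
have t1' : 1 - t != 0 by rewrite gt_eqF// subr_gt0 (le_lt_trans (ler_norm t)).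
have sK n : `|series b n| <= K * q ^+ n.
  elim: n => [|n IHn]; first by rewrite /series/= big_geq// normr0 mulr_ge0.
  rewrite /series/= big_nat_recr//=; apply: (le_trans (ler_normD _ _)).
  apply: (le_trans (lerD IHn (bK n))); rewrite exprS.
  have : 0 <= K * q ^+ n by rewrite mulr_ge0// exprn_ge0// ltW.
  by rewrite mulrCA; nra.
have -> : pseries (fun n => series b n.+1) t =
    (fun n => (1 - t)^-1 * (pseries b t n - t ^+ n * series b n)).
  apply/funext => n; apply: (mulfI t1'); rewrite mulVKf//.
  elim: n => [|n IHn].
    by rewrite /pseries /series/= !big_geq// !mulr0 subr0.
  rewrite /pseries /series/= !big_nat_recr//= mulrDr.
  rewrite /pseries /series/= in IHn; rewrite IHn exprS; ring.
apply: cvgMl_tmp; rewrite -[l]subr0; apply: cvgB => //.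
apply/norm_cvg0P.
apply: (@squeeze_cvgr _ _ _ _ (cst 0) (geometric K (`|t| * q))).
- near=> n; rewrite normr_ge0/= normrM normrX exprMn mulrCA.
  by rewrite ler_wpM2l ?exprn_ge0.
- exact: cvg_cst.
- by apply: cvg_geometric; rewrite ger0_norm// mulr_ge0// ltW.
Unshelve. all: by end_near. Qed.

(** * Bounds on degenerate factorials *)

(** The constant [c] is free: it is chosen later so that [expR (c |y|)], at a
    random [y], is integrable. *)
Lemma degen_falling_bound (R : realType) (lambda c y : R) (k : nat) : 0 < c ->
  `|degen_falling lambda y k / k`!%:R| <=
    expR (c * `|y|) * (expR (c * `|lambda|) / c) ^+ k.
Proof.
move=> c0; pose u := `|y| + k%:R * `|lambda|.
have u0 : 0 <= u by rewrite addr_ge0// mulr_ge0.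
have fu : `|degen_falling lambda y k| <= u ^+ k.
  rewrite normr_prod -[k in _ ^+ k]card_ord -prodr_const; apply: ler_prod => i _.
  rewrite normr_ge0/= (le_trans (ler_normB _ _))// lerD2l normrM normr_nat.
  by rewrite ler_wpM2r// ler_nat ltnW.
have fact_gt0 : 0 < (k`!%:R : R) by rewrite ltr0n fact_gt0.
have eu : (c * u) ^+ k / k`!%:R <= expR (c * u).
  have cu : 0 <= c * u by rewrite mulr_ge0// ltW.
  case: k @u {u0 fu fact_gt0} cu => [|k] u cu.
    by rewrite expr0 divr1 (le_trans _ (expR_ge1Dx _))// lerDl.
  by apply: le_trans (expR_ge1Dxn k cu); rewrite lerDr.
have -> : expR (c * `|y|) * (expR (c * `|lambda|) / c) ^+ k =
    expR (c * u) / c ^+ k.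
  rewrite expr_div_n mulrA -expRM_natl -expRD; congr (expR _ / _).
  by rewrite /u -mulr_natl; ring.
rewrite normrM [X in _ * X]gtr0_norm ?invr_gt0//.
rewrite ler_pdivlMr ?exprn_gt0//; apply: le_trans eu.
rewrite exprMn mulrAC ler_wpM2r ?invr_ge0 ?(ltW fact_gt0)//.
by rewrite mulrC ler_wpM2l ?exprn_ge0// ltW.
Qed.

Lemma degen_falling_opp (R : realType) (lambda y : R) (k : nat) :
  degen_falling lambda (- y) k = (-1) ^+ k * degen_rising lambda y k.
Proof.
rewrite /degen_falling /degen_rising -[k in (-1) ^+ k]card_ord.
by rewrite -prodrN; apply: eq_bigr => i _; rewrite opprD.
Qed.

(** * Expectations of dominated power series *)

(** [expR (c |y|)] is at most [expR (c y) + expR (- c y)], the sum of the two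
    moment generating functions after taking expectations. *)
Lemma integrable_expR_norm d (T : measurableType d) (R : realType)
    (P : probability T R) (Y : {RV P >-> R}) (c x : R) : 0 <= c ->
  ('M_P Y c < +oo)%E -> ('M_P Y (- c) < +oo)%E ->
  P.-integrable setT (fun w => (expR (c * `|x - Y w|))%:E).
Proof.
move=> c0 Yc YNc.
have mY : measurable_fun setT (Y : T -> R) by exact: measurable_funPT.
have int t : ('M_P Y t < +oo)%E ->
    P.-integrable setT (EFin \o (fun w => expR (t * Y w))).
  move=> Yt; apply/integrableP; split.
    by apply/measurable_EFinP; apply: measurableT_comp => //; exact: measurable_funM.
  apply: le_lt_trans Yt; rewrite /mmt_gen_fun unlock le_eqVlt; apply/orP; left.
  apply/eqP/eq_integral => w _ /=.
  by rewrite ger0_norm ?expR_ge0// mulrC.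
have dom : P.-integrable setT (fun w => (expR (c * `|x|))%:E *
    ((expR (c * Y w))%:E + (expR (- c * Y w))%:E))%E.
  by apply: integrableZl => //; apply: integrableD; [|exact: int..].
apply: le_integrable dom => //.
  apply/measurable_EFinP; apply: measurableT_comp => //; apply: measurable_funM => //.
  by apply: measurableT_comp => //; exact: measurable_funB.
move=> w _ /=; rewrite lee_fin [leLHS]ger0_norm ?expR_ge0//.
rewrite [leRHS]ger0_norm ?mulr_ge0 ?addr_ge0 ?expR_ge0//.
apply: (@le_trans _ _ (expR (c * `|x|) * expR (c * `|Y w|))).
  by rewrite -expRD ler_expR -mulrDr ler_wpM2l// ler_normB.
rewrite ler_wpM2l ?expR_ge0//.
have [Y0|Y0] := leP 0 (Y w); first by rewrite ger0_norm// lerDl expR_ge0.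
by rewrite ltr0_norm// mulrN mulNr lerDr expR_ge0.
Qed.

Lemma integrable_of_bound d (T : measurableType d) (R : realType)
    (P : probability T R) (f g : T -> R) (C : R) :
  measurable_fun setT f -> P.-integrable setT (EFin \o g) ->
  (forall w, `|f w| <= g w * C) -> P.-integrable setT (EFin \o f).
Proof.
move=> mf ig fg.
apply: (le_integrable measurableT (g := fun w => ((g w)%:E * C%:E)%E)).
- exact/measurable_EFinP.
- by move=> w _ /=; rewrite lee_fin (le_trans (fg w))// ler_norm.
- exact: integrableZr.
Qed.

Lemma norm_expectation_le d (T : measurableType d) (R : realType)
    (P : probability T R) (f g : T -> R) (C : R) :
  measurable_fun setT f -> P.-integrable setT (EFin \o g) ->
  (forall w, `|f w| <= g w * C) ->
  `|fine 'E_P[f]%E| <= fine 'E_P[g]%E * C.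
Proof.
move=> mf ig fg; have intf := integrable_of_bound mf ig fg.
rewrite unlock; apply: (le_trans (le_normr_Rintegral measurableT intf)).
rewrite mulrC /fine -/(fine _) -/(Rintegral _ _ _) -RintegralZl//.
apply: le_Rintegral => // [||w _]; last by rewrite mulrC.
- exact/integrable_norm.
- exact: integrableZl ig.
Qed.

(** Every partial sum is dominated by the integrable function
    [g / (1 - |t| q)]. *)
Lemma expectation_pseries d (T : measurableType d) (R : realType)
    (P : probability T R) (f : nat -> T -> R) (g : T -> R) (q t : R) :
  (forall k, measurable_fun setT (f k)) ->
  P.-integrable setT (EFin \o g) -> 0 <= q ->
  (forall k w, `|f k w| <= g w * q ^+ k) -> `|t| * q < 1 ->
  'E_P[fun w => limn (pseries (f^~ w) t)]%E \is a fin_num /\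
  pseries (fun k => fine 'E_P[f k]%E) t @ \oo -->
    fine 'E_P[fun w => limn (pseries (f^~ w) t)]%E.
Proof.
move=> mf ig q0 fg tq.
have tq0 : 0 <= `|t| * q by rewrite mulr_ge0.
have g0 w : 0 <= g w by have := fg 0 w; rewrite expr0 mulr1; exact: le_trans.
have cf w : cvgn (pseries (f^~ w) t).
  exact: (@cvg_pseries_of_bound _ _ (g w) q).
have intf k : P.-integrable setT (EFin \o f k).
  exact: integrable_of_bound (mf k) ig (fg k).
have intft k : P.-integrable setT (fun w => (f k w * t ^+ k)%:E).
  under eq_fun do rewrite EFinM.
  by apply: integrableZr => //; exact: intf.
have mp n : measurable_fun setT (fun w => pseries (f^~ w) t n).
  by apply: measurable_sum => k; exact: measurable_funM.
have bnd n w : `|pseries (f^~ w) t n| <= g w * (1 - `|t| * q)^-1.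
  apply: (le_trans (ler_norm_sum _ _ _)).
  apply: (@le_trans _ _ (g w * \sum_(0 <= k < n) (`|t| * q) ^+ k)); last first.
    by rewrite ler_wpM2l// sum_expr_le// tq0.
  rewrite mulr_sumr; apply: ler_sum => k _.
  by rewrite normrM normrX exprMn (mulrC (`|t| ^+ _)) mulrA ler_wpM2r ?exprn_ge0.
have [|||||intl _ cvl] := @dominated_convergence _ _ _ P setT measurableT
    (fun n w => (pseries (f^~ w) t n)%:E)
    (fun w => (limn (pseries (f^~ w) t))%:E)
    (fun w => ((g w)%:E * ((1 - `|t| * q)^-1)%:E)%E).
  - by move=> n; apply/measurable_EFinP; exact: mp.
  - apply/measurable_EFinP; apply: (measurable_fun_cvg mp) => w _; exact: cf.
  - by apply: aeW => w _; apply: cvg_EFin; [exact: nearW|exact: cf].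
  - exact: integrableZr.
  - by apply: aeW => w n _; rewrite lee_fin bnd.
have Efin : 'E_P[fun w => limn (pseries (f^~ w) t)]%E \is a fin_num.
  by rewrite unlock; exact: integrable_fin_num.
split=> //.
have -> : pseries (fun k => fine 'E_P[f k]%E) t =
    (fun n => fine (\int[P]_w (pseries (f^~ w) t n)%:E)%E).
  apply/funext => n; rewrite /pseries /series/=.
  under [in RHS]eq_integral do rewrite -sumEFin.
  rewrite (integral_sum measurableT intft) -sum_fine; last first.
    by move=> k _; exact: integrable_fin_num.
  apply: eq_bigr => k _; under [in RHS]eq_integral do rewrite EFinM.
  rewrite integralZr//; last exact: intf.
  rewrite fineM// ?unlock//.
  by apply: integrable_fin_num => //; exact: intf.
apply: fine_cvg; rewrite fineK// unlock; exact: cvl.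
Qed.

(** * Derangement polynomials *)

Lemma derangement_gf_inj d (T : measurableType d) (R : realType)
    (P : probability T R) (Y : {RV P >-> R}) (lambda x : R) (a b : nat -> R) :
  derangement_gf Y lambda x a -> derangement_gf Y lambda x b -> a = b.
Proof.
move=> ga gb; have ab : (fun n => a n / n`!%:R) = (fun n => b n / n`!%:R).
  apply: pseries_inj; near=> t.
  have [ca la] : cvgn (pseries (fun n => a n / n`!%:R) t) /\
    (((1 - t)^-1)%:E * 'E_P[fun w => degen_exp lambda (x - Y w) t] =
      (limn (pseries (fun n => a n / n`!%:R) t))%:E)%E by near: t.
  have [cb lb] : cvgn (pseries (fun n => b n / n`!%:R) t) /\
    (((1 - t)^-1)%:E * 'E_P[fun w => degen_exp lambda (x - Y w) t] =
      (limn (pseries (fun n => b n / n`!%:R) t))%:E)%E by near: t.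
  by split=> //; apply: EFin_inj; rewrite -la -lb.
apply/funext => n; have := congr1 (fun f => f n) ab; apply: mulIf.
by rewrite invr_neq0// pnatr_eq0 -lt0n fact_gt0.
Unshelve. all: by end_near. Qed.

Lemma derangement_poly_of_gf d (T : measurableType d) (R : realType)
    (P : probability T R) (Y : {RV P >-> R}) (lambda x : R) (a : nat -> R)
    (n : nat) :
  derangement_gf Y lambda x a -> derangement_poly Y lambda n x = a n.
Proof.
move=> ga; rewrite /derangement_poly.
by rewrite (derangement_gf_inj (xgetPex (fun=> 0) (ex_intro _ a ga)) ga).
Qed.

Lemma measurable_degen_falling d (T : measurableType d) (R : realType)
    (P : probability T R) (Y : {RV P >-> R}) (lambda x : R) (k : nat) :
  measurable_fun setT (fun w => degen_falling lambda (x - Y w) k).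
Proof.
by apply: measurable_prod => i _; apply: measurable_funB => //;
  exact: measurable_funB.
Qed.

(** The [k]-th coefficient of the power series [E[e_lambda^(x - Y)(t)]]. *)
Definition degen_exp_mean_coef d (T : measurableType d) (R : realType)
    (P : probability T R) (Y : {RV P >-> R}) (lambda x : R) (k : nat) : R :=
  fine 'E_P[fun w => (degen_falling lambda (x - Y w) k / k`!%:R)%R]%E.

Section FiniteMgf.
Context d (T : measurableType d) (R : realType) (P : probability T R).
Context (Y : {RV P >-> R}) (lambda r : R).
Context (r_gt0 : 0 < r).
Context (mgfY : forall t : R, `|t| < r -> ('M_P Y t < +oo)%E).

Let c := r / 2.
Let q := Num.max 2 (expR (c * `|lambda|) / c).
Let f x k w := degen_falling lambda (x - Y w) k / k`!%:R.
Let g x w := expR (c * `|x - Y w|).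

Let c_gt0 : 0 < c. Proof. by rewrite divr_gt0. Qed.

Let q_ge2 : 2 <= q. Proof. by rewrite le_max lexx. Qed.

Let q_gt0 : 0 < q. Proof. exact: lt_le_trans q_ge2. Qed.

Let measurable_f x k : measurable_fun setT (f x k).
Proof. by apply: measurable_funM => //; exact: measurable_degen_falling. Qed.

Let integrable_g x : P.-integrable setT (EFin \o g x).
Proof.
have cr : c < r by rewrite /c; move: r_gt0; lra.
by apply: integrable_expR_norm; rewrite ?ltW//; apply: mgfY;
  rewrite ?normrN gtr0_norm.
Qed.

Let f_le_g x k w : `|f x k w| <= g x w * q ^+ k.
Proof.
apply: (le_trans (degen_falling_bound _ _ _ c_gt0)).
rewrite ler_wpM2l ?expR_ge0// lerXn2r ?nnegrE ?(ltW q_gt0)//.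
  by rewrite divr_ge0 ?expR_ge0// ltW.
by rewrite le_max lexx orbT.
Qed.

Lemma integrable_degen_falling x k :
  P.-integrable setT (EFin \o (fun w => degen_falling lambda (x - Y w) k)).
Proof.
apply: (@integrable_of_bound _ _ _ _ _ (g x) (q ^+ k * k`!%:R)).
- exact: measurable_degen_falling.
- exact: integrable_g.
- move=> w; rewrite mulrA -ler_pdivrMr ?ltr0n ?fact_gt0//.
  apply: le_trans (f_le_g x k w).
  by rewrite /f normrM [X in _ <= _ * X]gtr0_norm// invr_gt0 ltr0n fact_gt0.
Qed.

(** The factorial cancels the one in the generating function, which leaves the
    partial sums of [degen_exp_mean_coef]: the effect of dividing by [1 - t]. *)
Lemma derangement_gf_partial_sums x :
  derangement_gf Y lambda x
    (fun n => n`!%:R * series (degen_exp_mean_coef Y lambda x) n.+1).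
Proof.
rewrite /derangement_gf /=.
have -> : (fun n => n`!%:R * series (degen_exp_mean_coef Y lambda x) n.+1 / n`!%:R)
    = (fun n => series (degen_exp_mean_coef Y lambda x) n.+1).
  by apply/funext => n; rewrite mulrAC mulfV ?mul1r.
have qV_gt0 : 0 < q^-1 by rewrite invr_gt0.
have near_q : \forall t \near (0 : R), `|t| < q^-1 := @nbhs0_lt _ R^o _ qV_gt0.
near=> t.
have tq : `|t| * q < 1 by rewrite -ltr_pdivlMr// div1r; near: t.
have [Efin cE] := expectation_pseries (measurable_f x) (integrable_g x)
  (ltW q_gt0) (f_le_g x) tq.
have bnd k : `|degen_exp_mean_coef Y lambda x k| <= fine 'E_P[g x]%E * q ^+ k.
  exact: (norm_expectation_le (measurable_f x k) (integrable_g x) (f_le_g x k)).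
have := cvg_pseries_partial_sums bnd q_ge2 tq cE => cS.
split; first by apply/cvgP: cS.
rewrite (cvg_lim _ cS)// EFinM; congr (_ * _)%E.
by rewrite fineK.
Unshelve. all: by end_near. Qed.

Lemma expectation_degen_falling x n : (1 <= n)%N ->
  'E_P[fun w => degen_falling lambda (x - Y w) n]%E =
  (derangement_poly Y lambda n x
     - n%:R * derangement_poly Y lambda n.-1 x)%:E.
Proof.
case: n => // n _.
rewrite /= !(derangement_poly_of_gf _ (derangement_gf_partial_sums x)).
rewrite mulrA -natrM -factS -mulrBr [series _ n.+2]/series/= big_nat_recr//=.
rewrite [X in X + _ - _]/(series _ _) addrAC subrr add0r /degen_exp_mean_coef.
have Lfall := (Lfun1_integrable P _).2 (integrable_degen_falling x n.+1).
have -> := expectationZl n.+1`!%:R^-1 Lfall.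
by rewrite fineM ?expectation_fin_num//= mulVKf// fineK ?expectation_fin_num.
Qed.

Lemma expectation_degen_rising n :
  (((-1) ^+ n)%:E * 'E_P[fun w => degen_rising lambda (Y w) n] =
   'E_P[fun w => degen_falling lambda (0 - Y w) n])%E.
Proof.
have fallE w : degen_falling lambda (0 - Y w) n =
    (-1) ^+ n * degen_rising lambda (Y w) n by rewrite sub0r degen_falling_opp.
have Lfall := (Lfun1_integrable P _).2 (integrable_degen_falling 0 n).
have -> : (fun w => degen_rising lambda (Y w) n) =
    (-1) ^+ n \o* (fun w => degen_falling lambda (0 - Y w) n).
  by apply/funext => w; rewrite /= fallE mulrAC -expr2 sqrr_sign mul1r.
by rewrite expectationZl// muleA -EFinM -expr2 sqrr_sign mul1e.
Qed.

End FiniteMgf.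

Theorem theorem2p1 (d : measure_display) (T : measurableType d) (R : realType)
    (P : probability T R) (Y : {RV P >-> R}) (lambda r : R)
    (lambda_neq0 : lambda != 0) (r_gt0 : 0 < r)
    (mgfY : forall t : R, `|t| < r -> ('M_P Y t < +oo)%E) :
  (forall (x : R) (n : nat), (1 <= n)%N ->
     'E_P[fun w => degen_falling lambda (x - Y w) n]%E =
     (derangement_poly Y lambda n x
        - n%:R * derangement_poly Y lambda n.-1 x)%:E) /\
  (forall n : nat, (1 <= n)%N ->
     (((-1) ^+ n)%:E * 'E_P[fun w => degen_rising lambda (Y w) n])%E =
     (derangement_number Y lambda n
        - n%:R * derangement_number Y lambda n.-1)%:E).
Proof.
split=> [x n n_ge1|n n_ge1].
  exact: (expectation_degen_falling lambda r_gt0 mgfY).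
rewrite (expectation_degen_rising lambda r_gt0 mgfY).
exact: (expectation_degen_falling lambda r_gt0 mgfY).
Qed.
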